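(* Let $R:=\mathsf S_{\mathfrak M}\operatorname{Del}N^{\star}_{\mathfrak H^{+}}N_{\mathfrak H^{+}}:\mathfrak H\to\mathbf{Gra}$. Then $R$ can be factored as $$R=Z_{\mathbf{Gra}}^{-1}\,N^{\diamond}_{\mathbf{Digra}}\,\mathsf S_{\mathfrak Q}\,\vec R\,\mathsf N_{\mathfrak R}\,C\,N_{\mathfrak H^{+}}.$$
   Context: Juxtaposition of functors denotes composition. $\mathcal P$ is the covariant power-set functor, $\mathcal P(f)(A)=\{f(x):x\in A\}$. Categories. - $\mathfrak H$: objects are set-system hypergraphs $G=(E(G),\epsilon_G,V(G))$ with $\epsilon_G:E(G)\to\mathcal P(V(G))$ a function; morphisms are pairs of functions $(E(\phi),V(\phi))$ with $\epsilon_H(E(\phi)(e))=\mathcal P(V(\phi))(\epsilon_G(e))$ for all $e$. - $\mathfrak H^{+}$: same objects; morphisms are pairs of functions $(E^{+}(\phi),V^{+}(\phi))$ with $\mathcal P(V^{+}(\phi))(\epsilon_G(e))\subseteq\epsilon_H(E^{+}(\phi)(e))$ for all $e$. - $\mathfrak M$: full subcategory of $\mathfrak H$ of those $G$ with $1\le\operatorname{card}(\epsilon_G(e))\le 2$ for all $e$. - $\mathbf{Gra}$: objects $(V(G),E(G))$ with $E(G)\subseteq\mathcal P(V(G))$, $1\le\operatorname{card}(A)\le2$ for $A\in E(G)$; morphisms are functions $f:V(G)\to V(G')$ with $\mathcal P(f)(A)\in E(G')$ for $A\in E(G)$. - $\mathfrak Q$ (quivers): $Q=(\vec V(Q),\vec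 E(Q),\sigma_Q,\tau_Q)$ with $\sigma_Q,\tau_Q:\vec E(Q)\to\vec V(Q)$; morphisms are pairs $(\vec V(\phi),\vec E(\phi))$ commuting with sources and targets. - $\mathbf{Digra}$: $Q=(\vec V(Q),\vec E(Q))$ with $\vec E(Q)\subseteq\vec V(Q)\times\vec V(Q)$; morphisms are functions on vertices preserving the relation. $\mathbf{SDigra}$: the full subcategory of symmetric digraphs. - $\mathfrak R$ (incidence hypergraphs): $G=(\check V(G),\check E(G),I(G),\varsigma_G,\omega_G)$ with $\varsigma_G:I(G)\to\check V(G)$, $\omega_G:I(G)\to\check E(G)$; morphisms are triples of functions $(\check V(\phi),\check E(\phi),I(\phi))$ commuting with $\varsigma,\omega$. - $\mathbf{IStr}$: $G=(\check V(G),\check E(G),I(G))$ with $I(G)\subseteq\check V(G)\times\check E(G)$; morphisms are pairs of functions $(f,g)$ with $(v,e)\in I(G)\Rightarrow(f(v),g(e))\in I(G')$. Functors. - $N_{\mathfrak H^{+}}:\mathfrak H\to\mathfrak H^{+}$: inclusion. - $N^{\star}_{\mathfrak H^{+}}:\mathfrak H^{+}\to\mathfrak H$: vertex set $V(G)$, edge set $\{(e,A):e\in E(G),\ A\subseteq\epsilon_G(e)\}$, endpoint map $(e,A)\mapsto A$; on morphisms $V^{+}(\phi)$ on vertices and $(e,A)\mapsto(E^{+}(\phi)(e),\mathcal P(V^{+}(\phi))(A))$ on edges. - $\operatorname{Del}:\mathfrak H\to\mathfrak M$: keeps all vertices and exactly the edges with one or two endpoints; restricts morphisms. - $\mathsf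 S_{\mathfrak M}:\mathfrak M\to\mathbf{Gra}$: $G\mapsto(V(G),\{\epsilon_G(e):e\in E(G)\})$, $\phi\mapsto V(\phi)$. - $C:\mathfrak H^{+}\to\mathbf{IStr}$ (an isomorphism of categories): $C(G)=(V(G),E(G),\{(v,e):v\in\epsilon_G(e)\})$, $C(\phi)=(V^{+}(\phi),E^{+}(\phi))$. - $\mathsf N_{\mathfrak R}:\mathbf{IStr}\to\mathfrak R$: $G\mapsto(\check V(G),\check E(G),I(G),\varsigma,\omega)$ with $\varsigma(v,e)=v$, $\omega(v,e)=e$; $(f,g)\mapsto(f,g,(v,e)\mapsto(f(v),g(e)))$. - $\vec R:\mathfrak R\to\mathfrak Q$: $\vec R(G)$ has vertex set $\check V(G)$, edge set $\{(i,j)\in I(G)\times I(G):\omega_G(i)=\omega_G(j)\}$, source $(i,j)\mapsto\varsigma_G(i)$, target $(i,j)\mapsto\varsigma_G(j)$; on morphisms $\check V(\phi)$ on vertices and $(i,j)\mapsto(I(\phi)(i),I(\phi)(j))$ on edges. - $\mathsf S_{\mathfrak Q}:\mathfrak Q\to\mathbf{Digra}$: $Q\mapsto(\vec V(Q),\{(\sigma_Q(e),\tau_Q(e)):e\in\vec E(Q)\})$, $\phi\mapsto\vec V(\phi)$. - $N^{\diamond}_{\mathbf{Digra}}:\mathbf{Digra}\to\mathbf{SDigra}$: symmetric closure, same vertices, edges $\{(v,w):(v,w)\in\vec E(Q)\text{ or }(w,v)\in\vec E(Q)\}$, identity on underlying functions. - $Z_{\mathbf{Gra}}:\mathbf{Gra}\to\mathbf{SDigra}$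 (an isomorphism of categories): $G\mapsto(V(G),\{(v,w):\{v,w\}\in E(G)\})$, $f\mapsto f$. *)

(* Defs.v *)
From mathcomp Require Import all_boot.
From mathcomp Require Import boolp classical_sets functions cardinality.

Set Implicit Arguments.
Unset Strict Implicit.
Unset Printing Implicit Defensive.
#[local] Obligation Tactic := idtac.

Local Open Scope classical_set_scope.
Local Open Scope card_scope.

Record category := Category {
  obj :> Type;
  hom : obj -> obj -> Type;
  idm : forall x, hom x x;
  compm : forall x y z, hom y z -> hom x y -> hom x z;
  compm1 : forall x y (f : hom x y), compm f (idm x) = f;
  comp1m : forall x y (f : hom x y), compm (idm y) f = f;
  compmA : forall x y z t (h : hom z t) (g : hom y z) (f : hom x y),
    compm h (compm g f) = compm (compm h g) f }.

Arguments hom {c} x y.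
Arguments idm {c} x.
Arguments compm {c x y z} g f.

Record functor (C D : category) := Functor {
  fobj :> obj C -> obj D;
  fmap : forall x y : C, hom x y -> hom (fobj x) (fobj y);
  fmap1 : forall x : C, fmap (idm x) = idm (fobj x);
  fmapM : forall (x y z : C) (g : hom y z) (f : hom x y),
    fmap (compm g f) = compm (fmap g) (fmap f) }.

Arguments fmap {C D} f0 {x y} f.

Definition functor_id (C : category) : functor C C :=
  @Functor C C id (fun _ _ f => f) (fun _ => erefl) (fun _ _ _ _ _ => erefl).

Program Definition functor_comp (C D E : category)
    (G : functor D E) (F : functor C D) : functor C E :=
  @Functor C E (fun x => G (F x)) (fun _ _ f => fmap G (fmap F f)) _ _.
Next Obligation. by move=> C D E G F x /=; rewrite !fmap1. Qed.
Next Obligation. by move=> C D E G F x y z g f /=; rewrite !fmapM. Qed.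

Notation "G '\oF' F" := (functor_comp G F)
  (at level 50, left associativity, format "G  \oF  F").

Record cat_iso (C D : category) := CatIso {
  iso_fun :> functor C D;
  iso_inv : functor D C;
  iso_funK : iso_inv \oF iso_fun = functor_id C;
  iso_invK : iso_fun \oF iso_inv = functor_id D }.

Program Definition full_sub (C : category) (P : C -> Prop) : category :=
  @Category {x : C | P x} (fun x y => hom (sval x) (sval y))
    (fun x => idm (sval x)) (fun x y z g f => compm g f) _ _ _.
Next Obligation. by move=> C P x y f; exact: compm1. Qed.
Next Obligation. by move=> C P x y f; exact: comp1m. Qed.
Next Obligation. by move=> C P x y z t h g f; exact: compmA. Qed.

(** Functors are compared by Leibniz equality: equal object maps and, modulo
    transport along the induced equalities, equal morphism maps. *)

Definition hom_cast (C : category) (x x' y y' : C) (ex : x = x') (ey : y = y')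
    (f : hom x y) : hom x' y' :=
  let: erefl := ex in let: erefl := ey in f.

Lemma functor_eq (C D : category) (F G : functor C D)
    (eo : forall x, F x = G x) :
  (forall (x y : C) (f : hom x y),
     hom_cast (eo x) (eo y) (fmap F f) = fmap G f) ->
  F = G.
Proof.
case: F eo => Fo Fm F1 FM; case: G => Go Gm G1 GM /= eo.
have e : Fo = Go by exact/funext.
subst Go => em.
have e : Fm = Gm.
  apply: functional_extensionality_dep => x.
  apply: functional_extensionality_dep => y.
  apply: functional_extensionality_dep => f.
  rewrite -em (Prop_irrelevance (eo x) erefl) (Prop_irrelevance (eo y) erefl).
  by [].
by subst Gm; rewrite (Prop_irrelevance F1 G1) (Prop_irrelevance FM GM).
Qed.

Lemma sval_eq (T : Type) (P : T -> Prop) (x y : {t : T | P t}) :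
  sval x = sval y -> x = y.
Proof. by case: x y => [x px] [y py] /= e; exact: eq_exist. Qed.

(** [1 <= card A <= 2] for a possibly infinite [T]; [`I_n] is [{0, ..., n-1}]. *)
Definition card12 (T : Type) (A : set T) : Prop :=
  (`I_1 #<= A) && (A #<= `I_2).

Lemma card12P (T : Type) (A : set T) :
  card12 A <-> exists v w, A = [set v; w].
Proof.
split=> [/andP[A1 A2]|[v [w ->]]]; last first.
  apply/andP; split.
    rewrite -(card_le_eql (@card_set1 T v)).
    by apply: subset_card_le => x ->; left.
  have -> : [set v; w] = (fun n => if n is 0 then v else w) @` `I_2.
    apply/seteqP; split=> x /=.
      by case=> ->; [exists 0|exists 1].
    by case=> -[|n] _ <-; [left|right].
  exact: card_image_le.
have [v Av] : A !=set0.
  apply/set0P/eqP => A0; move: A1; rewrite A0 card_le0 => /eqP I0.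
  suff : (set0 : set nat) 0 by [].
  by rewrite -I0.
have [[w [Aw wv]]|noW] := pselect (exists w, A w /\ w <> v).
  exists v, w.
  apply/seteqP; split=> u /=; last by case=> ->.
  move=> Au; have /card_leP[f] := A2.
  have finj (x y : A) : f x = f y -> \val x = \val y.
    by move=> /(@inj _ _ _ f) -> //; rewrite inE.
  have flt (x : A) : (\val (f x) < 2)%N.
    by have := set_valP (f x).
  pose a x (Ax : A x) : A := SigSub (mem_set Ax).
  have [uv|uv] := pselect (u = v); first by left.
  have [uw|uw] := pselect (u = w); first by right.
  have val_neq (x y : A) : \val x <> \val y -> \val (f x) <> \val (f y).
    by move=> xy /val_inj /finj.
  have h1 := val_neq (a _ Au) (a _ Av) uv.
  have h2 := val_neq (a _ Au) (a _ Aw) uw.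
  have h3 := val_neq (a _ Aw) (a _ Av) wv.
  move: h1 h2 h3 (flt (a _ Au)) (flt (a _ Av)) (flt (a _ Aw)).
  by do 3 case: (\val _) => [|[|?]].
exists v, v; apply/seteqP; split=> u /=; last by case=> ->.
move=> Au; left; apply: contrapT => uv; apply: noW; by exists u.
Qed.

Lemma card12_image (T U : Type) (f : T -> U) (A : set T) :
  card12 A -> card12 (f @` A).
Proof.
by case/card12P=> v [w ->]; apply/card12P; exists (f v), (f w);
   rewrite image_setU !image_set1.
Qed.

Lemma card12_set2 (T : Type) (v w : T) : card12 [set v; w].
Proof. by apply/card12P; exists v, w. Qed.

Record hypergraph := Hypergraph {
  hypE : Type;
  hypV : Type;
  hyp_ends : hypE -> set hypV }.

Record hyp_hom (G H : hypergraph) := HypHom {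
  hyp_homE : hypE G -> hypE H;
  hyp_homV : hypV G -> hypV H;
  hyp_homP : forall e,
    hyp_ends (hyp_homE e) = hyp_homV @` (hyp_ends e) }.

Lemma hyp_hom_eq (G H : hypergraph) (f g : hyp_hom G H) :
  hyp_homE f = hyp_homE g -> hyp_homV f = hyp_homV g -> f = g.
Proof.
case: f g => [fE fV fP] [gE gV gP] /= e e'; subst gE gV.
by rewrite (Prop_irrelevance fP gP).
Qed.

Program Definition catH : category :=
  @Category hypergraph hyp_hom
    (fun G => @HypHom G G id id _)
    (fun G H K g f => @HypHom G K (hyp_homE g \o hyp_homE f)
                                  (hyp_homV g \o hyp_homV f) _) _ _ _.
Next Obligation. by move=> G e; rewrite image_id. Qed.
Next Obligation. by move=> G H K g f e /=; rewrite !hyp_homP image_comp. Qed.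
Next Obligation. by move=> *; exact: hyp_hom_eq. Qed.
Next Obligation. by move=> *; exact: hyp_hom_eq. Qed.
Next Obligation. by move=> *; exact: hyp_hom_eq. Qed.

(** The suffix [p] (as in [catHp], [N_Hp]) stands for the superscript [+]. *)
Record hypp_hom (G H : hypergraph) := HyppHom {
  hypp_homE : hypE G -> hypE H;
  hypp_homV : hypV G -> hypV H;
  hypp_homP : forall e,
    hypp_homV @` (hyp_ends e) `<=` hyp_ends (hypp_homE e) }.

Lemma hypp_hom_eq (G H : hypergraph) (f g : hypp_hom G H) :
  hypp_homE f = hypp_homE g -> hypp_homV f = hypp_homV g -> f = g.
Proof.
case: f g => [fE fV fP] [gE gV gP] /= e e'; subst gE gV.
by rewrite (Prop_irrelevance fP gP).
Qed.

Program Definition catHp : category :=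
  @Category hypergraph hypp_hom
    (fun G => @HyppHom G G id id _)
    (fun G H K g f => @HyppHom G K (hypp_homE g \o hypp_homE f)
                                   (hypp_homV g \o hypp_homV f) _) _ _ _.
Next Obligation. by move=> G e; rewrite image_id. Qed.
Next Obligation.
move=> G H K g f e /=; rewrite -image_comp.
apply: (@subset_trans _ (hypp_homV g @` hyp_ends (hypp_homE f e))).
  exact/image_subset/hypp_homP.
exact: hypp_homP.
Qed.
Next Obligation. by move=> *; exact: hypp_hom_eq. Qed.
Next Obligation. by move=> *; exact: hypp_hom_eq. Qed.
Next Obligation. by move=> *; exact: hypp_hom_eq. Qed.

Definition catM : category :=
  @full_sub catH (fun G => forall e : hypE G, card12 (hyp_ends e)).

Record graph := Graph {
  graV : Type;
  graE : set (set graV);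
  gra_card : forall A, graE A -> card12 A }.

Definition gra_hom (G H : graph) :=
  {f : graV G -> graV H | forall A, graE A -> graE (f @` A)}.

Program Definition Gra : category :=
  @Category graph gra_hom
    (fun G => exist _ id _)
    (fun G H K g f => exist _ (sval g \o sval f) _) _ _ _.
Next Obligation. by move=> G A; rewrite image_id. Qed.
Next Obligation.
by move=> G H K [g gP] [f fP] A EA /=; rewrite -image_comp; apply/gP/fP.
Qed.
Next Obligation. by move=> *; exact: sval_eq. Qed.
Next Obligation. by move=> *; exact: sval_eq. Qed.
Next Obligation. by move=> *; exact: sval_eq. Qed.

Lemma graph_eq (V : Type) (E1 E2 : set (set V)) p1 p2 :
  E1 = E2 -> @Graph V E1 p1 = @Graph V E2 p2.
Proof. by move=> e; subst E2; rewrite (Prop_irrelevance p1 p2). Qed.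

Lemma gra_cast (V V' : Type) (E1 E2 : set (set V)) p1 p2
    (E1' E2' : set (set V')) p1' p2'
    (e : @Graph V E1 p1 = @Graph V E2 p2)
    (e' : @Graph V' E1' p1' = @Graph V' E2' p2')
    (f : @hom Gra (@Graph V E1 p1) (@Graph V' E1' p1')) :
  E1 = E2 -> E1' = E2' ->
  sval (@hom_cast Gra _ _ _ _ e e' f) = sval f.
Proof.
move=> h h'; subst E2 E2'.
have h := Prop_irrelevance p1 p2; have h' := Prop_irrelevance p1' p2'.
subst p2 p2'.
by rewrite (Prop_irrelevance e erefl) (Prop_irrelevance e' erefl).
Qed.

Record quiver := Quiver {
  quivV : Type;
  quivE : Type;
  quiv_src : quivE -> quivV;
  quiv_tgt : quivE -> quivV }.

Record quiv_hom (P Q : quiver) := QuivHom {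
  quiv_homV : quivV P -> quivV Q;
  quiv_homE : quivE P -> quivE Q;
  quiv_hom_src : forall e, quiv_src (quiv_homE e) = quiv_homV (quiv_src e);
  quiv_hom_tgt : forall e, quiv_tgt (quiv_homE e) = quiv_homV (quiv_tgt e) }.

Lemma quiv_hom_eq (P Q : quiver) (f g : quiv_hom P Q) :
  quiv_homV f = quiv_homV g -> quiv_homE f = quiv_homE g -> f = g.
Proof.
case: f g => [fV fE fs ft] [gV gE gs gt] /= e e'; subst gV gE.
by rewrite (Prop_irrelevance fs gs) (Prop_irrelevance ft gt).
Qed.

Program Definition catQ : category :=
  @Category quiver quiv_hom
    (fun P => @QuivHom P P id id _ _)
    (fun P Q S g f => @QuivHom P S (quiv_homV g \o quiv_homV f)
                                   (quiv_homE g \o quiv_homE f) _ _) _ _ _.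
Next Obligation. by []. Qed.
Next Obligation. by []. Qed.
Next Obligation. by move=> P Q S g f e /=; rewrite !quiv_hom_src. Qed.
Next Obligation. by move=> P Q S g f e /=; rewrite !quiv_hom_tgt. Qed.
Next Obligation. by move=> *; exact: quiv_hom_eq. Qed.
Next Obligation. by move=> *; exact: quiv_hom_eq. Qed.
Next Obligation. by move=> *; exact: quiv_hom_eq. Qed.

Record digraph := Digraph {
  digV : Type;
  digE : set (digV * digV) }.

Definition dig_hom (P Q : digraph) :=
  {f : digV P -> digV Q | forall v w, digE (v, w) -> digE (f v, f w)}.

Program Definition Digra : category :=
  @Category digraph dig_hom
    (fun P => exist _ id _)
    (fun P Q S g f => exist _ (sval g \o sval f) _) _ _ _.
Next Obligation. by []. Qed.
Next Obligation. by move=> P Q S [g gP] [f fP] v w E /=; apply/gP/fP. Qed.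
Next Obligation. by move=> *; exact: sval_eq. Qed.
Next Obligation. by move=> *; exact: sval_eq. Qed.
Next Obligation. by move=> *; exact: sval_eq. Qed.

Definition dig_sym (Q : digraph) : Prop :=
  forall v w : digV Q, digE (v, w) -> digE (w, v).

Definition SDigra : category := @full_sub Digra dig_sym.

Lemma sdig_eq (V : Type) (E1 E2 : set (V * V)) p1 p2 :
  E1 = E2 ->
  exist _ (Digraph E1) p1 = exist _ (Digraph E2) p2 :> {Q | dig_sym Q}.
Proof. by move=> e; subst E2; exact: sval_eq. Qed.

Lemma sdig_cast (V V' : Type) (E1 E2 : set (V * V)) p1 p2
    (E1' E2' : set (V' * V')) p1' p2'
    (e : exist _ (Digraph E1) p1 = exist _ (Digraph E2) p2 :> obj SDigra)
    (e' : exist _ (Digraph E1') p1' = exist _ (Digraph E2') p2' :> obj SDigra)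
    (f : @hom SDigra (exist _ (Digraph E1) p1) (exist _ (Digraph E1') p1')) :
  E1 = E2 -> E1' = E2' ->
  sval (@hom_cast SDigra _ _ _ _ e e' f) = sval f.
Proof.
move=> h h'; subst E2 E2'.
have h := Prop_irrelevance p1 p2; have h' := Prop_irrelevance p1' p2'.
subst p2 p2'.
by rewrite (Prop_irrelevance e erefl) (Prop_irrelevance e' erefl).
Qed.

Record inc_hypergraph := IncHypergraph {
  incV : Type;
  incE : Type;
  incI : Type;
  inc_vert : incI -> incV;
  inc_edge : incI -> incE }.

Record inc_hom (G H : inc_hypergraph) := IncHom {
  inc_homV : incV G -> incV H;
  inc_homE : incE G -> incE H;
  inc_homI : incI G -> incI H;
  inc_hom_vert : forall i, inc_vert (inc_homI i) = inc_homV (inc_vert i);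
  inc_hom_edge : forall i, inc_edge (inc_homI i) = inc_homE (inc_edge i) }.

Lemma inc_hom_eq (G H : inc_hypergraph) (f g : inc_hom G H) :
  inc_homV f = inc_homV g -> inc_homE f = inc_homE g ->
  inc_homI f = inc_homI g -> f = g.
Proof.
case: f g => [fV fE fI fv fe] [gV gE gI gv ge] /= e e' e''; subst gV gE gI.
by rewrite (Prop_irrelevance fv gv) (Prop_irrelevance fe ge).
Qed.

Program Definition catR : category :=
  @Category inc_hypergraph inc_hom
    (fun G => @IncHom G G id id id _ _)
    (fun G H K g f => @IncHom G K (inc_homV g \o inc_homV f)
                                  (inc_homE g \o inc_homE f)
                                  (inc_homI g \o inc_homI f) _ _) _ _ _.
Next Obligation. by []. Qed.
Next Obligation. by []. Qed.
Next Obligation. by move=> G H K g f e /=; rewrite !inc_hom_vert. Qed.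
Next Obligation. by move=> G H K g f e /=; rewrite !inc_hom_edge. Qed.
Next Obligation. by move=> *; exact: inc_hom_eq. Qed.
Next Obligation. by move=> *; exact: inc_hom_eq. Qed.
Next Obligation. by move=> *; exact: inc_hom_eq. Qed.

Record inc_structure := IncStructure {
  istrV : Type;
  istrE : Type;
  istrI : set (istrV * istrE) }.

Record istr_hom (G H : inc_structure) := IstrHom {
  istr_homV : istrV G -> istrV H;
  istr_homE : istrE G -> istrE H;
  istr_homP : forall v e, istrI (v, e) -> istrI (istr_homV v, istr_homE e) }.

Lemma istr_hom_eq (G H : inc_structure) (f g : istr_hom G H) :
  istr_homV f = istr_homV g -> istr_homE f = istr_homE g -> f = g.
Proof.
case: f g => [fV fE fP] [gV gE gP] /= e e'; subst gV gE.
by rewrite (Prop_irrelevance fP gP).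
Qed.

Program Definition IStr : category :=
  @Category inc_structure istr_hom
    (fun G => @IstrHom G G id id _)
    (fun G H K g f => @IstrHom G K (istr_homV g \o istr_homV f)
                                   (istr_homE g \o istr_homE f) _) _ _ _.
Next Obligation. by []. Qed.
Next Obligation. by move=> G H K g f v e Ive; do 2 apply: istr_homP. Qed.
Next Obligation. by move=> *; exact: istr_hom_eq. Qed.
Next Obligation. by move=> *; exact: istr_hom_eq. Qed.
Next Obligation. by move=> *; exact: istr_hom_eq. Qed.

Program Definition N_Hp : functor catH catHp :=
  @Functor catH catHp id
    (fun G H f => @HyppHom G H (hyp_homE f) (hyp_homV f) _) _ _.
Next Obligation. by move=> G H f e; rewrite hyp_homP. Qed.
Next Obligation. by move=> *; exact: hypp_hom_eq. Qed.
Next Obligation. by move=> *; exact: hypp_hom_eq. Qed.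

Definition Nstar_obj (G : hypergraph) : hypergraph :=
  @Hypergraph {p : hypE G * set (hypV G) | p.2 `<=` hyp_ends p.1} (hypV G)
    (fun p => (sval p).2).

Program Definition Nstar_map (G H : hypergraph) (f : hypp_hom G H) :
    hyp_hom (Nstar_obj G) (Nstar_obj H) :=
  @HypHom (Nstar_obj G) (Nstar_obj H)
    (fun p => exist _ (hypp_homE f (sval p).1, hypp_homV f @` (sval p).2) _)
    (hypp_homV f) _.
Next Obligation.
move=> G H f [[e A] /= Ae].
apply: (@subset_trans _ (hypp_homV f @` hyp_ends e)).
  exact: image_subset.
exact: hypp_homP.
Qed.
Next Obligation. by []. Qed.

Program Definition Nstar_Hp : functor catHp catH :=
  @Functor catHp catH Nstar_obj Nstar_map _ _.
Next Obligation.
move=> G; apply: hyp_hom_eq => //=; apply/funext => -[[e A] Ae].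
by apply: sval_eq; rewrite /= image_id.
Qed.
Next Obligation.
move=> G H K g f; apply: hyp_hom_eq => //=; apply/funext => -[[e A] Ae].
by apply: sval_eq; rewrite /= image_comp.
Qed.

Definition Del_hyp (G : hypergraph) : hypergraph :=
  @Hypergraph {e : hypE G | card12 (hyp_ends e)} (hypV G)
    (fun e => hyp_ends (sval e)).

Program Definition Del_obj (G : catH) : catM := exist _ (Del_hyp G) _.
Next Obligation. by move=> G [e eP]. Qed.

Program Definition Del_map (G H : catH) (f : hyp_hom G H) :
    hyp_hom (Del_hyp G) (Del_hyp H) :=
  @HypHom (Del_hyp G) (Del_hyp H)
    (fun e => exist _ (hyp_homE f (sval e)) _) (hyp_homV f) _.
Next Obligation.
by move=> G H f [e /= eP]; rewrite hyp_homP; exact: card12_image.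
Qed.
Next Obligation. by move=> G H f [e /= eP]; rewrite hyp_homP. Qed.

Program Definition Del : functor catH catM :=
  @Functor catH catM Del_obj Del_map _ _.
Next Obligation.
move=> G; apply: hyp_hom_eq => //=; apply/funext => e; exact: sval_eq.
Qed.
Next Obligation.
move=> G H K g f; apply: hyp_hom_eq => //=; apply/funext => e; exact: sval_eq.
Qed.

Program Definition S_M_obj (G : catM) : Gra :=
  @Graph (hypV (sval G)) (range (@hyp_ends (sval G))) _.
Next Obligation. by move=> [G GP] A [e _ <-]; exact: GP. Qed.

Program Definition S_M : functor catM Gra :=
  @Functor catM Gra S_M_obj (fun G H f => exist _ (hyp_homV f) _) _ _.
Next Obligation.
move=> G H f A [e _ <-]; exists (hyp_homE f e) => //; exact: hyp_homP.
Qed.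
Next Obligation. by move=> *; exact: sval_eq. Qed.
Next Obligation. by move=> *; exact: sval_eq. Qed.

Definition C_obj (G : catHp) : IStr :=
  @IncStructure (hypV G) (hypE G) [set p | hyp_ends p.2 p.1].

Program Definition C_Hp : functor catHp IStr :=
  @Functor catHp IStr C_obj
    (fun G H f => @IstrHom (C_obj G) (C_obj H) (hypp_homV f) (hypp_homE f) _)
    _ _.
Next Obligation. by move=> G H f v e ve; apply: hypp_homP; exists v. Qed.
Next Obligation. by move=> *; exact: istr_hom_eq. Qed.
Next Obligation. by move=> *; exact: istr_hom_eq. Qed.

Definition N_R_obj (G : IStr) : catR :=
  @IncHypergraph (istrV G) (istrE G) {p : istrV G * istrE G | istrI p}
    (fun p => (sval p).1) (fun p => (sval p).2).

Program Definition N_R_map (G H : IStr) (f : istr_hom G H) :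
    inc_hom (N_R_obj G) (N_R_obj H) :=
  @IncHom (N_R_obj G) (N_R_obj H) (istr_homV f) (istr_homE f)
    (fun p => exist _ (istr_homV f (sval p).1, istr_homE f (sval p).2) _) _ _.
Next Obligation. by move=> G H f [[v e] /= ve]; exact: istr_homP. Qed.
Next Obligation. by []. Qed.
Next Obligation. by []. Qed.

Program Definition N_R : functor IStr catR :=
  @Functor IStr catR N_R_obj N_R_map _ _.
Next Obligation.
move=> G; apply: inc_hom_eq => //=; apply/funext => -[[v e] ve].
exact: sval_eq.
Qed.
Next Obligation.
move=> G H K g f; apply: inc_hom_eq => //=; apply/funext => -[[v e] ve].
exact: sval_eq.
Qed.

Definition vecR_obj (G : catR) : catQ :=
  @Quiver (incV G) {p : incI G * incI G | inc_edge p.1 = inc_edge p.2}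
    (fun p => inc_vert (sval p).1) (fun p => inc_vert (sval p).2).

Program Definition vecR_map (G H : catR) (f : inc_hom G H) :
    quiv_hom (vecR_obj G) (vecR_obj H) :=
  @QuivHom (vecR_obj G) (vecR_obj H) (inc_homV f)
    (fun p => exist _ (inc_homI f (sval p).1, inc_homI f (sval p).2) _) _ _.
Next Obligation. by move=> G H f [[i j] /= ij]; rewrite !inc_hom_edge ij. Qed.
Next Obligation. by move=> G H f p /=; exact: inc_hom_vert. Qed.
Next Obligation. by move=> G H f p /=; exact: inc_hom_vert. Qed.

Program Definition vecR : functor catR catQ :=
  @Functor catR catQ vecR_obj vecR_map _ _.
Next Obligation.
move=> G; apply: quiv_hom_eq => //=; apply/funext => -[[i j] ij].
exact: sval_eq.
Qed.
Next Obligation.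
move=> G H K g f; apply: quiv_hom_eq => //=; apply/funext => -[[i j] ij].
exact: sval_eq.
Qed.

Definition S_Q_obj (Q : catQ) : Digra :=
  @Digraph (quivV Q) (range (fun e : quivE Q => (quiv_src e, quiv_tgt e))).

Program Definition S_Q : functor catQ Digra :=
  @Functor catQ Digra S_Q_obj (fun P Q f => exist _ (quiv_homV f) _) _ _.
Next Obligation.
move=> P Q f v w [e _ [<- <-]]; exists (quiv_homE f e) => //.
by rewrite quiv_hom_src quiv_hom_tgt.
Qed.
Next Obligation. by move=> *; exact: sval_eq. Qed.
Next Obligation. by move=> *; exact: sval_eq. Qed.

Program Definition Ndiamond_obj (Q : Digra) : SDigra :=
  exist _
    (@Digraph (digV Q) [set p | digE (p.1, p.2) \/ digE (p.2, p.1)]) _.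
Next Obligation. by move=> Q v w /= [|] ?; [right|left]. Qed.

Program Definition Ndiamond_Digra : functor Digra SDigra :=
  @Functor Digra SDigra Ndiamond_obj (fun P Q f => exist _ (sval f) _) _ _.
Next Obligation.
by move=> P Q [f fP] v w /= [|] /fP ?; [left|right].
Qed.
Next Obligation. by move=> *; exact: sval_eq. Qed.
Next Obligation. by move=> *; exact: sval_eq. Qed.

Program Definition Z_obj (G : Gra) : SDigra :=
  exist _ (@Digraph (graV G) [set p | graE [set p.1; p.2]]) _.
Next Obligation. by move=> G v w /=; rewrite setUC. Qed.

Program Definition Z_fun : functor Gra SDigra :=
  @Functor Gra SDigra Z_obj (fun G H f => exist _ (sval f) _) _ _.
Next Obligation.
by move=> G H [f fP] v w /= /fP; rewrite image_setU !image_set1.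
Qed.
Next Obligation. by move=> *; exact: sval_eq. Qed.
Next Obligation. by move=> *; exact: sval_eq. Qed.

Program Definition Zinv_obj (Q : SDigra) : Gra :=
  @Graph (digV (sval Q)) [set [set p.1; p.2] | p in @digE (sval Q)] _.
Next Obligation. by move=> Q A [p _ <-]; exact: card12_set2. Qed.

Program Definition Zinv_fun : functor SDigra Gra :=
  @Functor SDigra Gra Zinv_obj (fun P Q f => exist _ (sval f) _) _ _.
Next Obligation.
move=> P Q [f fP] A [[v w] /= /fP vw <-]; exists (f v, f w) => //=.
by rewrite image_setU !image_set1.
Qed.
Next Obligation. by move=> *; exact: sval_eq. Qed.
Next Obligation. by move=> *; exact: sval_eq. Qed.

Lemma Z_graE (V : Type) (E : set (set V)) (p : forall A, E A -> card12 A) :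
  [set [set q.1; q.2] | q in [set q : V * V | E [set q.1; q.2]]] = E.
Proof.
apply/seteqP; split=> [A [[v w] /= vw <-] //|A EA].
have /card12P[v [w Avw]] := p _ EA.
by exists (v, w) => /=; rewrite -Avw.
Qed.

Lemma set2_eq (T : Type) (a b v w : T) :
  [set a; b] = [set v; w] -> (a, b) = (v, w) \/ (a, b) = (w, v).
Proof.
move=> e.
have va : [set v; w] a by rewrite -e; left.
have vb : [set v; w] b by rewrite -e; right.
have av : [set a; b] v by rewrite e; left.
have aw : [set a; b] w by rewrite e; right.
case: va vb av aw => /= -> [] /= ->; [|by left|by right|].
  by move=> _ [] ->; left.
by move=> [] ->; left.
Qed.

Lemma Z_digE (V : Type) (E : set (V * V)) (p : dig_sym (Digraph E)) :
  [set q : V * V |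
     [set [set r.1; r.2] | r in E] [set q.1; q.2]] = E.
Proof.
apply/seteqP; split=> [[v w] [[a b] /= ab]|[v w] vw]; last by exists (v, w).
by case/(@set2_eq V a b v w) => -[<- <-] //; exact: p.
Qed.

Lemma Z_funK : Zinv_fun \oF Z_fun = functor_id Gra.
Proof.
have eo (G : Gra) : (Zinv_fun \oF Z_fun) G = functor_id Gra G.
  by case: G => V E p; apply: graph_eq; exact: Z_graE.
apply: (functor_eq (eo := eo)) => -[V E p] [V' E' p'] f; apply: sval_eq.
by rewrite gra_cast //; exact: Z_graE.
Qed.

Lemma Z_invK : Z_fun \oF Zinv_fun = functor_id SDigra.
Proof.
have eo (Q : SDigra) : (Z_fun \oF Zinv_fun) Q = functor_id SDigra Q.
  by case: Q => -[V E] p; apply: sdig_eq; exact: Z_digE.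
apply: (functor_eq (eo := eo)) => -[[V E] p] [[V' E'] p'] f; apply: sval_eq.
by rewrite sdig_cast //; exact: Z_digE.
Qed.

Definition Z_Gra : cat_iso Gra SDigra := CatIso Z_funK Z_invK.

(* Main.v *)
(** Both composites keep the vertices and act as [hyp_homV] on morphisms.  On
    the left, the edges of the graph of [G] are the sets of one or two vertices
    contained in an edge of [G]; on the right, they are the sets [{v, w}] such
    that [v] and [w] both lie in a common edge of [G]. *)

From mathcomp Require Import all_boot.
From mathcomp Require Import boolp classical_sets.
Require Import Defs.

Local Open Scope classical_set_scope.

(** [Nstar_Hp] makes each subset of an edge an edge, and [Del] then keeps those with one or two
    vertices. *)
Lemma graE_Nstar (G : catH) (A : set (hypV G)) :
  @graE ((S_M \oF Del \oF Nstar_Hp \oF N_Hp) G) A <->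
  card12 A /\ exists e : hypE G, A `<=` hyp_ends e.
Proof.
split=> [[[[[e B] /= Be] /= B12] _ /= <-]|[A12 [e Ae]]].
  by split=> //; exists e.
by exists (exist _ (exist (fun p => p.2 `<=` hyp_ends p.1) (e, A) Ae) A12).
Qed.

Lemma digE_incidence (G : catH) (v w : hypV G) :
  @digE ((S_Q \oF vecR \oF N_R \oF C_Hp \oF N_Hp) G) (v, w) <->
  exists e : hypE G, hyp_ends e v /\ hyp_ends e w.
Proof.
split=> [[[[[[a e] /= ae] [[b e'] /= be']] /= ee'] _ /= [<- <-]]|[e [ve we]]].
  by exists e; rewrite {2}ee'.
pose i u ue : incI (N_R (C_Hp (N_Hp G))) :=
  exist (fun p : hypV G * hypE G => hyp_ends p.2 p.1) (u, e) ue.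
by exists (exist (fun p => inc_edge p.1 = inc_edge p.2)
                (i v ve, i w we) erefl).
Qed.

Lemma graE_incidence (G : catH) (A : set (hypV G)) :
  @graE ((iso_inv Z_Gra \oF Ndiamond_Digra \oF S_Q \oF vecR \oF N_R \oF C_Hp
            \oF N_Hp) G) A <->
  card12 A /\ exists e : hypE G, A `<=` hyp_ends e.
Proof.
split=> [[[v w] vw <-]|[/card12P[v [w ->]] [e vwe]]].
  split; first exact: card12_set2.
  (* Lying in a common edge is symmetric in [v] and [w], so the symmetric closure adds no pair. *)
  by case: vw => /digE_incidence[e [? ?]]; exists e => _ [] ->.
exists (v, w) => //; left; apply/digE_incidence; exists e.
by split; apply: vwe; [left|right].
Qed.

Theorem proposition4p7 :
  let R : functor catH Gra := S_M \oF Del \oF Nstar_Hp \oF N_Hp in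
  R = iso_inv Z_Gra \oF Ndiamond_Digra \oF S_Q \oF vecR \oF N_R \oF C_Hp
        \oF N_Hp.
Proof.
move=> R; rewrite {}/R.
set F := (X in X = _); set F' := (X in _ = X).
have eE (G : catH) : @graE (F G) = @graE (F' G).
  by apply/funext => A; apply/propext; rewrite graE_Nstar graE_incidence.
(* The vertex types agree by computation, so only the edge sets are compared. *)
have eo (G : catH) : F G = F' G by apply: graph_eq; exact: eE.
apply: (functor_eq (eo := eo)) => G H f; apply: sval_eq.
(* The cast along [eo] keeps the vertex map, and both sides compute to [hyp_homV f]. *)
by rewrite gra_cast //; exact: eE.
Qed.
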